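(* Let $n\geq2$. Let $a_1,\dots,a_{n-1}>0$, $\psi_1,\dots,\psi_{n-1}\in\mathbb{R}$, $E>1$ and $\alpha\geq0$ be constants. For $j=1,\dots,n-1$ define $r_j:\mathbb{R}\to\mathbb{R}$ by $r_j(s)=\sqrt{\frac{1}{a_j}+s^2}$ and $\phi_j:\mathbb{R}\to\mathbb{R}$ by $$\phi_j(s)=\psi_j+\int_0^s\frac{|t|}{\big(\frac{1}{a_j}+t^2\big)\sqrt{E\{\prod_{k=1}^{n-1}(1+a_kt^2)\}e^{\alpha t^2}-1}}\,dt.$$ Then the submanifold $L$ in $\mathbb{C}^n$ given by $$L=\Big\{\Big(x_1r_1(s)e^{i\phi_1(s)},\dots,x_{n-1}r_{n-1}(s)e^{i\phi_{n-1}(s)},\ -\frac12\sum_{j=1}^{n-1}x_j^2+\frac12s^2+i\int_0^s\frac{|t|\,dt}{\sqrt{E\{\prod_{k=1}^{n-1}(1+a_kt^2)\}e^{\alpha t^2}-1}}\Big)\ :\ x_1,\dots,x_{n-1}\in\mathbb{R},\ s\in\mathbb{R},\ s\neq0\Big\}$$ is an immersed Lagrangian submanifold diffeomorphic to $(\mathbb{R}\setminus\{0\})\times\mathbb{R}^{n-1}$, and its mean curvature vector $H$ satisfies $H\equiv T^{\perp}$, where $T=(0,\dots,0,\alpha)\in\mathbb{C}^n$.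
   Context: $\mathbb{C}^n\cong\mathbb{R}^{2n}$ carries its standard Euclidean metric, complex structure $J$ (multiplication by $i$) and symplectic form. $L$ is regarded as an immersed submanifold via the displayed parametrization by $((x_1,\dots,x_{n-1}),s)\in\mathbb{R}^{n-1}\times(\mathbb{R}\setminus\{0\})$; ''diffeomorphic to'' refers to the domain of this immersion. $T^{\perp}$ denotes the orthogonal projection of the constant vector $T$ to the normal bundle of $L$, and $H$ is the mean curvature vector of $L$ (the trace of the second fundamental form). *)

(* Defs.v *)
From HB Require Import structures.
From mathcomp Require Import all_boot all_order all_algebra.
From mathcomp Require Import all_classical all_reals all_analysis.
From mathcomp Require Import complex.

Set Implicit Arguments.
Unset Strict Implicit.
Unset Printing Implicit Defensive.

Import Order.TTheory GRing.Theory Num.Theory.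
Import numFieldNormedType.Exports.

Local Open Scope classical_set_scope.
Local Open Scope ring_scope.
Local Open Scope complex_scope.

(* Throughout, n is written m + 1 (so m = n - 1): the domain R^(n-1) x R is
   'rV[R]_m * R, with points (x, s). *)

(* C^N viewed as R^(2N): the pair (u, v) stands for u + i v. The norm carried
   by this type is only used through its topology; the Euclidean metric is
   [edot]. *)
Definition RCn (R : realType) (N : nat) : normedModType R :=
  ('rV[R]_N * 'rV[R]_N)%type.

Definition realify (R : realType) (N : nat) (z : 'rV[R[i]]_N) : RCn R N :=
  (map_mx (@complex.Re R) z, map_mx (@complex.Im R) z).

Definition edot (R : realType) (N : nat) (z w : RCn R N) : R :=
  \sum_(k < N) (z.1 0 k * w.1 0 k + z.2 0 k * w.2 0 k).

(* The sum of the dx_k /\ dy_k; edot (J z) w = omega z w. *)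
Definition omega (R : realType) (N : nat) (z w : RCn R N) : R :=
  \sum_(k < N) (z.1 0 k * w.2 0 k - z.2 0 k * w.1 0 k).

(* C^k on D. For a finite-dimensional V and D open, f is C^(k+1) iff it is
   differentiable and all its directional derivatives are C^k. *)
Fixpoint Ck_on (R : realType) (V W : normedModType R) (k : nat)
    (D : set V) (f : V -> W) : Prop :=
  match k with
  | 0 => forall p, D p -> {for p, continuous f}
  | k'.+1 => (forall p, D p -> differentiable f p) /\
             (forall v : V, Ck_on k' D ('D_v f))
  end.

Definition smooth_on (R : realType) (V W : normedModType R)
    (D : set V) (f : V -> W) : Prop :=
  open D /\ forall k, Ck_on k D f.

Definition diffeomorphic (R : realType) (V W : normedModType R)
    (A : set V) (B : set W) : Prop :=
  exists (f : V -> W) (g : W -> V),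
    [/\ smooth_on A f, smooth_on B g,
        (forall p, A p -> B (f p) /\ g (f p) = p) &
        (forall q, B q -> A (g q) /\ f (g q) = q)].

Definition immersion_on (R : realType) (V W : normedModType R)
    (D : set V) (f : V -> W) : Prop :=
  smooth_on D f /\ forall p, D p -> injective ('d f p).

(* The domain has dimension m + 1, half of that of RCn R (m + 1), so
   isotropic immersions are Lagrangian. *)
Definition lagrangian_on (R : realType) (m : nat) (D : set ('rV[R]_m * R))
    (f : 'rV[R]_m * R -> RCn R (m + 1)) : Prop :=
  immersion_on D f /\
  forall p, D p -> forall v w, omega ('d f p v) ('d f p w) = 0.

Definition tangent_space (R : realType) (V : normedModType R) (N : nat)
    (f : V -> RCn R N) (p : V) : set (RCn R N) :=
  range ('d f p).

Definition normal_fiber (R : realType) (V : normedModType R) (N : nat)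
    (f : V -> RCn R N) (p : V) : set (RCn R N) :=
  [set y | forall t, tangent_space f p t -> edot y t = 0].

(* Orthogonal projection onto the normal space: the y normal with w - y
   tangent. *)
Definition normal_part (R : realType) (V : normedModType R) (N : nat)
    (f : V -> RCn R N) (p : V) (w : RCn R N) : RCn R N :=
  xget 0 [set y | normal_fiber f p y /\ tangent_space f p (w - y)].

(* II('d f p v, 'd f p w), with v and w extended to constant vector fields on
   the domain. *)
Definition second_fundamental_form (R : realType) (V : normedModType R)
    (N : nat) (f : V -> RCn R N) (p : V) (v w : V) : RCn R N :=
  normal_part f p ('D_v ('D_w f) p).

Definition coord_frame (R : realType) (m : nat) (i : 'I_(m + 1)) :
    'rV[R]_m * R :=
  match fintype.split i with
  | inl j => (delta_mx 0 j, 0)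
  | inr _ => (0, 1)
  end.

Definition induced_metric (R : realType) (m : nat)
    (f : 'rV[R]_m * R -> RCn R (m + 1)) (p : 'rV[R]_m * R) : 'M[R]_(m + 1) :=
  \matrix_(i, j) edot ('d f p (coord_frame R i)) ('d f p (coord_frame R j)).

(* The trace of II with respect to the induced metric, not divided by the
   dimension. *)
Definition mean_curvature (R : realType) (m : nat)
    (f : 'rV[R]_m * R -> RCn R (m + 1)) (p : 'rV[R]_m * R) : RCn R (m + 1) :=
  \sum_(i < m + 1) \sum_(j < m + 1)
    invmx (induced_metric f p) i j *:
      second_fundamental_form f p (coord_frame R i) (coord_frame R j).

(* The oriented integral from 0 to s. *)
Definition int0 (R : realType) (h : R -> R) (s : R) : R :=
  if 0 <= s then \int[lebesgue_measure]_(t in `[0, s]) h t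
  else - \int[lebesgue_measure]_(t in `[s, 0]) h t.

Definition expi (R : realType) (theta : R) : R[i] := cos theta +i* sin theta.

Definition rfun (R : realType) (m : nat) (a : 'I_m -> R) (j : 'I_m) (s : R)
    : R :=
  Num.sqrt ((a j)^-1 + s ^+ 2).

Definition denom (R : realType) (m : nat) (a : 'I_m -> R) (E alpha t : R) : R :=
  Num.sqrt (E * (\prod_(k < m) (1 + a k * t ^+ 2)) * expR (alpha * t ^+ 2) - 1).

Definition phi (R : realType) (m : nat) (a psi : 'I_m -> R) (E alpha : R)
    (j : 'I_m) (s : R) : R :=
  psi j +
  int0 (fun t => `|t| / (((a j)^-1 + t ^+ 2) * denom a E alpha t)) s.

Definition Lpoint (R : realType) (m : nat) (a psi : 'I_m -> R) (E alpha : R)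
    (x : 'rV[R]_m) (s : R) : 'rV[R[i]]_(m + 1) :=
  row_mx
    (\row_j ((x 0 j * rfun a j s)%:C * expi (phi a psi E alpha j s)))
    (\row__ ((- (1 / 2) * (\sum_j x 0 j ^+ 2) + 1 / 2 * s ^+ 2)
             +i* int0 (fun t => `|t| / denom a E alpha t) s)).

Definition Lset (R : realType) (m : nat) (a psi : 'I_m -> R) (E alpha : R)
    : set (RCn R (m + 1)) :=
  [set z | exists (x : 'rV[R]_m) (s : R),
     s != 0 /\ z = realify (Lpoint a psi E alpha x s)].

Definition Lparam (R : realType) (m : nat) (a psi : 'I_m -> R) (E alpha : R)
    (p : 'rV[R]_m * R) : RCn R (m + 1) :=
  realify (Lpoint a psi E alpha p.1 p.2).

Definition Ldomain (R : realType) (m : nat) : set ('rV[R]_m * R) :=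
  setT `*` [set s | s != 0].
Arguments Ldomain : clear implicits.

Definition Tvec (R : realType) (m : nat) (alpha : R) : RCn R (m + 1) :=
  realify (row_mx 0 (\row__ alpha%:C)).

(* Main.v *)
Require Import Defs.
From HB Require Import structures.
From mathcomp Require Import all_boot all_order all_algebra.
From mathcomp Require Import all_classical all_reals all_analysis.
From mathcomp Require Import complex ring lra.

Import Order.TTheory GRing.Theory Num.Theory.
Import numFieldNormedType.Exports.

Set Implicit Arguments.
Unset Strict Implicit.
Unset Printing Implicit Defensive.

Local Open Scope classical_set_scope.
Local Open Scope ring_scope.

(** Write w = s + i nu with nu = |s| / sqrt(radicand - 1), and let V be the
    vector with coordinates x_j e^(i phi_j) / r_j (for j < n) and 1. Since
    r_j' + i r_j phi_j' = w / r_j, the coordinate tangent vectors of L are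
      d_(x_j) L = r_j e^(i phi_j) e_j - x_j e_n   and   d_s L = w V.
    Their Hermitian products are real: they are r_j^2 delta_jk + x_j x_k
    between the d_(x_j) L, zero between d_(x_j) L and d_s L, and |w|^2 |V|^2
    for d_s L. The imaginary part of the Hermitian product is the symplectic
    form and its real part is the metric, so L is Lagrangian ([omega_dL]) and
    immersed ([dL_inj]), and the metric is the block matrix of
    diag(r_j^2) + x^T x and |w|^2 |V|^2, whose inverse is given by the
    Sherman-Morrison formula ([metric_mulV]).

    As the orthogonal projection to the normal space exists and is linear when
    the metric is invertible ([normal_part_linear]), the mean curvature vector
    is the normal part of the metric trace W of the second derivative of L
    ([mean_curvatureE]). Hence H is the normal part of T as soon as W - T is
    tangent ([normal_part_congr]). The coefficients of W - T in the coordinate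
    frame can be written down. The imaginary part of the last coordinate
    determines the coefficient of d_s L, the coordinates j < n determine those
    of d_(x_j) L, and the real part of the last coordinate gives one condition,
      nu - s nu' = nu |w|^2 (sum_k 1 / r_k^2 + alpha).
    It holds because the logarithmic derivative of the radicand
    E prod_k (1 + a_k s^2) e^(alpha s^2) is 2 s (sum_k 1 / r_k^2 + alpha)
    ([is_derive_nu], [trace_ddL_tangent]).

    On the analytic side, L is smooth for s <> 0 because C^k functions are
    stable under products and compositions, and because a function of one
    variable with a C^k derivative is C^(k+1); this covers the integrals through
    the fundamental theorem of calculus ([is_derive_int0]), |t| included since
    it is smooth away from 0. *)

(** * Smooth functions *)

(** Differentiability is a local property: g - f vanishes near p, so that 0 is
    its differential there. *)
Lemma near_eq_differentiable (R : realType) (V W : normedModType R)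
    (f g : V -> W) (p : V) :
  (\near p, f p = g p) -> differentiable f p -> differentiable g p.
Proof.
move=> fg df.
have -> : g = f + (g - f) by rewrite addrC subrK.
apply: differentiableD => //.
have h0 : (g - f) p = 0 by rewrite !fctE (nbhs_singleton fg) subrr.
have hexp : (g - f) \o shift p = cst ((g - f) p) + \0 +o_ 0 id.
  apply/eqaddoP => e e0; rewrite h0.
  have : \forall y \near p, (g - f) y = 0.
    by apply: filterS fg => y; rewrite !fctE => ->; rewrite subrr.
  rewrite (near_shift 0 p) => /= fg0; apply: filterS fg0 => y /=.
  rewrite subr0 => fg0.
  rewrite !fctE /= in fg0 *.
  by rewrite fg0 !addr0 subrr normr0 mulr_ge0 // ltW.
apply/diff_locallyP.
have dE := diff_unique (df := \0) (@cst_continuous _ _ _) hexp.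
rewrite dE; split => //.
exact: (@cst_continuous _ _ _).
Qed.

Section Ck_calculus.
Variable R : realType.
Implicit Types V W : normedModType R.

Lemma Ck_on_ext V W k (D : set V) (f g : V -> W) : open D ->
  (forall p, D p -> f p = g p) -> Ck_on k D f -> Ck_on k D g.
Proof.
move=> oD; elim: k f g => [|k IH] f g fg /=.
  move=> cf p Dp.
  have fgp : \near p, f p = g p.
    by apply: filterS (open_nbhs_nbhs (conj oD Dp)) => q; exact: fg.
  rewrite /prop_for /continuous_at -(fg _ Dp).
  exact: cvg_trans (near_eq_cvg fgp) (cf _ Dp).
move=> [df Ck]; split => [p Dp|v].
  apply: near_eq_differentiable (df _ Dp).
  by apply: filterS (open_nbhs_nbhs (conj oD Dp)) => q; exact: fg.
apply: IH (Ck v) => p Dp; apply: near_eq_derive.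
by apply: filterS (open_nbhs_nbhs (conj oD Dp)) => q; exact: fg.
Qed.

Lemma Ck_onW V W k (D : set V) (f : V -> W) : Ck_on k.+1 D f -> Ck_on k D f.
Proof.
elim: k f => [|k IH] f /= [df Ck].
  by move=> p Dp; exact: differentiable_continuous (df _ Dp).
by split => // v; apply: IH.
Qed.

Lemma Ck_on_sub V W k (A D : set V) (f : V -> W) : A `<=` D ->
  Ck_on k D f -> Ck_on k A f.
Proof.
move=> AD; elim: k f => [|k IH] f /=; first by move=> cf p /AD; exact: cf.
by move=> [df Ck]; split => [p /AD|v]; [exact: df|exact: IH].
Qed.

Lemma Ck_on_cst V W k (D : set V) (w : W) : Ck_on k D (cst w).
Proof.
elim: k w => [|k IH] w /=; first by move=> p _; exact: cst_continuous.
split => [p _|v]; first exact: differentiable_cst.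
by rewrite (_ : 'D_v (cst w) = cst 0) //; apply/funext => p; rewrite derive_cst.
Qed.

Lemma Ck_onD V W k (D : set V) (f g : V -> W) : open D ->
  Ck_on k D f -> Ck_on k D g -> Ck_on k D (fun p => f p + g p).
Proof.
move=> oD; elim: k f g => [|k IH] f g /=.
  by move=> cf cg p Dp; apply: continuousD; [exact: cf|exact: cg].
move=> [df Cf] [dg Cg]; split => [p Dp|v].
  by apply: differentiableD; [exact: df|exact: dg].
apply: Ck_on_ext (IH _ _ (Cf v) (Cg v)) => // p Dp.
by rewrite [RHS](@deriveD _ _ _ f g) //; apply: diff_derivable; [exact: df|exact: dg].
Qed.

Lemma Ck_on_sum V W k (D : set V) (I : Type) (r : seq I) (f : I -> V -> W) :
  open D -> (forall i, Ck_on k D (f i)) ->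
  Ck_on k D (fun p => \sum_(i <- r) f i p).
Proof.
move=> oD Cf; elim: r => [|i r IH].
  by under eq_fun do rewrite big_nil; exact: Ck_on_cst.
by under eq_fun do rewrite big_cons; exact: Ck_onD.
Qed.

Lemma Ck_on_scalel V W k (D : set V) (f : V -> R) (w : W) : open D ->
  Ck_on k D f -> Ck_on k D (fun p => f p *: w).
Proof.
move=> oD; elim: k f => [|k IH] f /=.
  move=> cf p Dp; apply: (@continuous_comp _ _ _ f ( *:%R^~ w)); first exact: cf.
  exact: scalel_continuous.
move=> [df Cf]; have dfw p : D p -> differentiable (fun q => f q *: w) p.
  by move=> Dp; apply: differentiableZl; exact: df.
split => [p Dp|v]; first exact: dfw.
apply: Ck_on_ext (IH _ (Cf v)) => // p Dp.
by rewrite [RHS]deriveE ?diffZl -?deriveE //; [exact: df|exact: df|exact: dfw].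
Qed.

Lemma Ck_onM V k (D : set V) (f g : V -> R) : open D ->
  Ck_on k D f -> Ck_on k D g -> Ck_on k D (fun p => f p * g p).
Proof.
move=> oD; elim: k f g => [|k IH] f g.
  by move=> cf cg p Dp; apply: continuousM; [exact: cf|exact: cg].
move=> Cf Cg; have [df Df] := Cf; have [dg Dg] := Cg.
split => [p Dp|v].
  by apply: differentiableM; [exact: df|exact: dg].
apply: Ck_on_ext (Ck_onD _ (IH _ _ (Ck_onW Cf) (Dg v)) (IH _ _ (Ck_onW Cg) (Df v)))
  => // p Dp.
by rewrite [RHS](@deriveM _ _ f g) //; apply: diff_derivable; [exact: df|exact: dg].
Qed.

Lemma Ck_on_prod V k (D : set V) (I : Type) (r : seq I) (f : I -> V -> R) :
  open D -> (forall i, Ck_on k D (f i)) ->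
  Ck_on k D (fun p => \prod_(i <- r) f i p).
Proof.
move=> oD Cf; elim: r => [|i r IH].
  by under eq_fun do rewrite big_nil; exact: Ck_on_cst.
by under eq_fun do rewrite big_cons; exact: Ck_onM.
Qed.

Lemma Ck_on_linear V W k (D : set V) (f : {linear V -> W}) :
  continuous f -> Ck_on k D f.
Proof.
move=> cf; case: k => [|k] /=; first by move=> p _; exact: cf.
split => [p _|v]; first exact: linear_differentiable.
rewrite (_ : 'D_v f = cst (f v)); first exact: Ck_on_cst.
apply/funext => p; rewrite deriveE; last exact: linear_differentiable.
by rewrite diff_lin.
Qed.

Lemma derive_scalar_comp V (f : V -> R) (h : R -> R) (p v : V) :
  differentiable f p -> differentiable h (f p) ->
  'D_v (h \o f) p = 'D_1 h (f p) * 'D_v f p.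
Proof.
move=> df dh; rewrite deriveE; last exact: differentiable_comp.
rewrite diff_comp //= -(deriveE v df).
have {1}-> : 'D_v f p = 'D_v f p *: (1 : R) by rewrite /GRing.scale /= mulr1.
by rewrite linearZ /= [X in _ = X * _]deriveE // mulrC.
Qed.

Lemma Ck_on_comp V k (D : set V) (B : set R) (f : V -> R) (h : R -> R) :
  open D -> (forall p, D p -> B (f p)) ->
  Ck_on k D f -> Ck_on k B h -> Ck_on k D (h \o f).
Proof.
move=> oD fB; elim: k h => [|k IH] h.
  by move=> cf ch p Dp; apply: continuous_comp; [exact: cf|exact/ch/fB].
move=> Cf Ch; have [df Df] := Cf; have [dh Dh] := Ch.
split => [p Dp|v].
  by apply: differentiable_comp; [exact: df|exact/dh/fB].
have CM := Ck_onM oD (IH _ (Ck_onW Cf) (Dh 1)) (Df v).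
apply: Ck_on_ext CM => // p Dp.
by rewrite [RHS]derive_scalar_comp //; [exact: df|exact/dh/fB].
Qed.

(** On the line, a function whose derivative is C^k is C^(k+1). *)
Lemma Ck_on_is_derive k (B : set R) (h h' : R -> R) : open B ->
  (forall t, B t -> is_derive t 1 h (h' t)) -> Ck_on k B h' ->
  Ck_on k.+1 B h.
Proof.
move=> oB hh' Ch'.
have dh t : B t -> differentiable h t.
  by move=> Bt; apply/derivable1_diffP; have [] := hh' _ Bt.
split => // v.
have CM := Ck_onM oB Ch' (@Ck_on_cst _ _ k B v).
apply: Ck_on_ext CM => // t Bt /=.
rewrite deriveE; last exact: dh.
rewrite -[in RHS](mulr1 v).
have -> : v * 1 = v *: (1 : R) by [].
rewrite linearZ /= -deriveE; last exact: dh.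
by have [_ ->] := hh' _ Bt; rewrite mulrC.
Qed.

Lemma Ck_on_id k (B : set R) : Ck_on k B (id : R -> R).
Proof.
by apply: (@Ck_on_linear _ _ k B (@idfun R)) => x.
Qed.

Lemma Ck_on_inv k : Ck_on k [set t : R | t != 0] (@GRing.inv R).
Proof.
elim: k => [|k IH]; first by move=> t t0; exact: inv_continuous.
have oB : open [set t : R | t != 0] by exact: open_neq.
apply: (@Ck_on_is_derive _ _ _ (fun t => (-1) * (t^-1 * t^-1))) => //.
  move=> t t0; apply: is_derive_eq.
    by apply: (@is_deriveV _ id) => //; exact: is_derive_id.
  by rewrite /GRing.scale /= mulr1 mulN1r -invfM -expr2.
by apply: Ck_onM => //; [exact: Ck_on_cst|exact: Ck_onM].
Qed.

Lemma Ck_on_expR k : Ck_on k setT (@expR R).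
Proof.
elim: k => [|k IH]; first by move=> t _; exact: continuous_expR.
by apply: Ck_on_is_derive IH; exact: openT.
Qed.

Lemma Ck_on_sin_cos k : Ck_on k setT (@sin R) /\ Ck_on k setT (@cos R).
Proof.
have oT : open [set: R] by exact: openT.
elim: k => [|k [IHs IHc]].
  by split => t _; [exact: continuous_sin|exact: continuous_cos].
split.
  by apply: Ck_on_is_derive IHc; exact: openT.
apply: (@Ck_on_is_derive _ _ _ (fun t => (-1) * sin t)) => //.
  by move=> t _; rewrite mulN1r; exact: is_derive_cos.
by apply: Ck_onM => //; exact: Ck_on_cst.
Qed.

Lemma Ck_on_sqrt k : Ck_on k [set t : R | 0 < t] (@Num.sqrt R).
Proof.
have oB : open [set t : R | 0 < t] by exact: open_gt.
elim: k => [|k IH]; first by move=> t _; exact: sqrt_continuous.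
apply: (@Ck_on_is_derive _ _ _ (fun t => (2 * Num.sqrt t)^-1)) => //.

apply: (@Ck_on_comp _ _ _ [set t : R | t != 0] (fun t => 2 * Num.sqrt t)) => //.
- by move=> t t0 /=; rewrite mulf_neq0 // gt_eqF // sqrtr_gt0.
- by apply: Ck_onM => //; exact: Ck_on_cst.
- exact: Ck_on_inv.
Qed.

Lemma is_derive_normr (t : R) : t != 0 -> is_derive t 1 Num.norm (Num.sg t).
Proof.
move=> t0; have [tn|tp|/eqP] := ltgtP t 0; last by rewrite (negPf t0).
  apply: (@near_eq_is_derive _ _ _ -%R).
    by near=> u; rewrite ltr0_norm //; near: u; exact: lt_nbhsl.
  by rewrite ltr0_sg //; exact: is_deriveNid.
apply: (@near_eq_is_derive _ _ _ id).
  by near=> u; rewrite gtr0_norm //; near: u; exact: lt_nbhsr.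
by rewrite gtr0_sg //; exact: is_derive_id.
Unshelve. all: by end_near. Qed.

Lemma is_derive_sgr (t : R) : t != 0 -> is_derive t 1 (@Num.sg R) 0.
Proof.
move=> t0; have [tn|tp|/eqP] := ltgtP t 0; last by rewrite (negPf t0).
  apply: (@near_eq_is_derive _ _ _ (fun=> -1 : R)).
  by near=> u; rewrite ltr0_sg //; near: u; exact: lt_nbhsl.
apply: (@near_eq_is_derive _ _ _ (fun=> 1 : R)).
by near=> u; rewrite gtr0_sg //; near: u; exact: lt_nbhsr.
Unshelve. all: by end_near. Qed.

Lemma Ck_on_normr k : Ck_on k [set t : R | t != 0] (@Num.norm R R).
Proof.
have oB : open [set t : R | t != 0] by exact: open_neq.
apply: Ck_onW; apply: (@Ck_on_is_derive _ _ _ (@Num.sg R)) => //.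
  by move=> t; exact: is_derive_normr.
apply: Ck_onW; apply: (@Ck_on_is_derive _ _ _ (cst 0)) => //.
  by move=> t; exact: is_derive_sgr.
exact: Ck_on_cst.
Qed.

End Ck_calculus.

(** * Coordinates of vector-valued maps and oriented integrals *)

Section components.
Variables (R : realType) (N : nat).

(** The real and imaginary parts of the k-th coordinate, as linear forms. *)
Definition re_part (k : 'I_N) (z : RCn R N) : R := z.1 0 k.
Definition im_part (k : 'I_N) (z : RCn R N) : R := z.2 0 k.

Fact re_part_linear k : linear (re_part k).
Proof. by move=> c z w; rewrite /re_part /= !mxE. Qed.
HB.instance Definition _ k :=
  GRing.isLinear.Build R (RCn R N) R _ (re_part k) (re_part_linear k).

Fact im_part_linear k : linear (im_part k).
Proof. by move=> c z w; rewrite /im_part /= !mxE. Qed.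
HB.instance Definition _ k :=
  GRing.isLinear.Build R (RCn R N) R _ (im_part k) (im_part_linear k).

Lemma re_part_continuous k : continuous (re_part k).
Proof.
move=> z; apply: (@continuous_comp _ _ _ fst (fun u : 'rV[R]_N => u 0 k)).
  exact: cvg_fst.
exact: coord_continuous.
Qed.

Lemma im_part_continuous k : continuous (im_part k).
Proof.
move=> z; apply: (@continuous_comp _ _ _ snd (fun u : 'rV[R]_N => u 0 k)).
  exact: cvg_snd.
exact: coord_continuous.
Qed.

Lemma RCnP (z w : RCn R N) :
  (forall k, re_part k z = re_part k w) ->
  (forall k, im_part k z = im_part k w) -> z = w.
Proof.
case: z w => [z1 z2] [w1 w2] e1 e2.
by congr pair; apply/rowP => k; [exact: e1|exact: e2].
Qed.

Lemma RCn_sum_parts (z : RCn R N) :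
  z = \sum_k (re_part k z *: ((delta_mx 0 k, 0) : RCn R N) +
              im_part k z *: ((0, delta_mx 0 k) : RCn R N)).
Proof.
case: z => [z1 z2]; rewrite big_split /=.
rewrite /re_part /im_part /=.
apply: RCnP => k; rewrite linearD !linear_sum /= /re_part /im_part /=.
  rewrite [X in _ + X]big1 => [|j _]; last by rewrite scaler0 mxE.
  rewrite addr0 {1}[z1]row_sum_delta summxE.
  by apply: eq_bigr => j _.
rewrite [X in X + _]big1 => [|j _]; last by rewrite scaler0 mxE.
rewrite add0r {1}[z2]row_sum_delta summxE.
by apply: eq_bigr => j _.
Qed.

(** C^k regularity can be checked on the real and imaginary parts of the
    coordinates. *)
Lemma Ck_on_parts (V : normedModType R) k (D : set V) (f : V -> RCn R N) :
  open D ->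
  (forall j, Ck_on k D (fun p => re_part j (f p))) ->
  (forall j, Ck_on k D (fun p => im_part j (f p))) -> Ck_on k D f.
Proof.
move=> oD Cre Cim.
have CS : Ck_on k D (fun p => \sum_j
    (re_part j (f p) *: ((delta_mx 0 j, 0) : RCn R N) +
     im_part j (f p) *: ((0, delta_mx 0 j) : RCn R N))).
  by apply: Ck_on_sum => // j; apply: Ck_onD => //; apply: Ck_on_scalel.
by apply: Ck_on_ext CS => // p _; rewrite -RCn_sum_parts.
Qed.

End components.

Lemma derive_linear_comp (R : realType) (V W U : normedModType R)
    (l : {linear W -> U}) (f : V -> W) (p v : V) :
  continuous l -> differentiable f p ->
  'D_v (l \o f) p = l ('D_v f p).
Proof.
move=> cl df.
have dl : differentiable l (f p) by exact: linear_differentiable.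
rewrite deriveE; last exact: differentiable_comp.
by rewrite diff_comp // diff_lin //= deriveE.
Qed.

(** The fundamental theorem of calculus for the oriented integral, on both
    sides of 0 and at 0 itself. *)
Lemma is_derive_int0 (R : realType) (h : R -> R) (s : R) :
  continuous h -> is_derive s 1 (int0 h) (h s).
Proof.
move=> ch.
(* With a base point a to the left of both 0 and s, int0 h x is the difference
   of the integrals of h over [a, x] and [a, 0] for every x > a. *)
pose a := Num.min 0 s - 1; pose u := Num.max 0 s + 1.
have [a0 as_] : a < 0 /\ a < s.
  have m0 : Num.min 0 s <= 0 by rewrite ge_min lexx.
  have ms : Num.min 0 s <= s by rewrite ge_min lexx orbT.
  by rewrite /a; split; lra.
have [u0 us] : 0 < u /\ s < u.
  have m0 : 0 <= Num.max 0 s by rewrite le_max lexx.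
  have ms : s <= Num.max 0 s by rewrite le_max lexx orbT.
  by rewrite /u; split; lra.
have hint x y : lebesgue_measure.-integrable `[x, y] (EFin \o h).
  apply: continuous_compact_integrable; first exact: segment_compact.
  exact: continuous_subspaceT.
pose G x := (\int[lebesgue_measure]_(t in `[a, x]) h t)%R.
have GE x : a < x -> int0 h x = G x - G 0.
  move=> ax; rewrite /int0 /G; case: leP => x0.
    rewrite (@Rintegral_itvB _ h (BLeft a) (BRight x) 0) //.
      rewrite Rintegral_itv_obnd_cbnd //.
      by apply: integrableS (hint 0 x) => //; exact: subset_itv_oc_cc.
    by rewrite bnd_simp ltW.
  rewrite -opprB; congr (- _).
  rewrite (@Rintegral_itvB _ h (BLeft a) (BRight 0) x) //.
  - rewrite Rintegral_itv_obnd_cbnd //.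
    by apply: integrableS (hint x 0) => //; exact: subset_itv_oc_cc.
  - by rewrite bnd_simp ltW.
  - by rewrite bnd_simp ltW.
have [dG G'] := @continuous_FTC1_closed R h a s u us (hint a u) as_ (ch s).
apply: (@near_eq_is_derive _ _ _ (fun x => G x - G 0)).
  by near=> x; rewrite GE //; near: x; exact: lt_nbhsr.
have hG : is_derive s 1 G (h s) by apply: DeriveDef => //; rewrite -derive1E.
have hB : is_derive s 1 (G - cst (G 0)) (h s - 0) by exact: is_deriveB.
by rewrite subr0 in hB.
Unshelve. all: by end_near. Qed.

(** * Orthogonal projection and mean curvature *)

Section euclidean.
Variables (R : realType) (N : nat).
Implicit Types z w y : RCn R N.

Lemma edotE z w :
  edot z w = \sum_k (re_part k z * re_part k w + im_part k z * im_part k w).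
Proof. by []. Qed.

Lemma edotC z w : edot z w = edot w z.
Proof. by rewrite !edotE; apply: eq_bigr => k _; ring. Qed.

Fact edot_linear z : linear (edot z).
Proof.
move=> c w y; rewrite !edotE scaler_sumr -big_split /=; apply: eq_bigr => k _.
by rewrite !linearP /= /GRing.scale /=; ring.
Qed.
HB.instance Definition _ z :=
  GRing.isLinear.Build R (RCn R N) R _ (edot z) (edot_linear z).

Lemma edot_eq0 z : edot z z = 0 -> z = 0.
Proof.
rewrite edotE => /psumr_eq0P z0.
have sq_ge0 k : 0 <= re_part k z * re_part k z + im_part k z * im_part k z.
  by rewrite -!expr2 addr_ge0 ?sqr_ge0.
have {}z0 k : re_part k z = 0 /\ im_part k z = 0.
  have /eqP := z0 (fun k _ => sq_ge0 k) k isT.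
  rewrite -!expr2 paddr_eq0 ?sqr_ge0 // !sqrf_eq0.
  by move=> /andP[/eqP -> /eqP ->].
by apply: RCnP => k; rewrite linear0; have [] := z0 k.
Qed.

End euclidean.

Section normal_projection.
Variables (R : realType) (V : normedModType R) (N : nat).
Variables (f : V -> RCn R N) (p : V).

Lemma tangent_space_linear c (z w : RCn R N) : tangent_space f p z ->
  tangent_space f p w -> tangent_space f p (c *: z + w).
Proof. by move=> [v _ <-] [u _ <-]; exists (c *: v + u) => //; rewrite linearP. Qed.

(** A vector that is both tangent and normal is zero, so that the decomposition
    into normal and tangential parts is unique. *)
Lemma normal_part_unique (w y : RCn R N) :
  normal_fiber f p y -> tangent_space f p (w - y) -> normal_part f p w = y.
Proof.
move=> ny ty; apply: xget_unique => // y' [ny' ty'].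
have tyy : tangent_space f p (y' - y).
  have -> : y' - y = (-1) *: (w - y') + (w - y).
    by rewrite scaleN1r opprB addrA subrK.
  exact: tangent_space_linear.
apply/eqP; rewrite -subr_eq0; apply/eqP/edot_eq0.
by rewrite linearB /= ![edot (y' - y) _]edotC ny // ny' // subrr.
Qed.

(** Vectors that differ by a tangent vector have the same decompositions into
    normal and tangential parts. *)
Lemma normal_part_congr (w w' : RCn R N) :
  tangent_space f p (w - w') -> normal_part f p w = normal_part f p w'.
Proof.
move=> t; rewrite /normal_part; congr xget; apply/seteqP; split => y /= [ny ty];
  split => //.
  have -> : w' - y = (-1) *: (w - w') + (w - y).
    by rewrite scaleN1r opprB addrA subrK.
  exact: tangent_space_linear.
have -> : w - y = 1 *: (w - w') + (w' - y) by rewrite scale1r addrA subrK.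
exact: tangent_space_linear.
Qed.

End normal_projection.

Section mean_curvature.
Variables (R : realType) (m : nat).
Variables (f : 'rV[R]_m * R -> RCn R (m + 1)) (p : 'rV[R]_m * R).

Lemma coord_frame_lshift (j : 'I_m) : coord_frame R (lshift 1 j) = (delta_mx 0 j, 0).
Proof. by rewrite /coord_frame (unsplitK (inl j)). Qed.

Lemma coord_frame_rshift (j : 'I_1) : coord_frame R (rshift m j) = (0, 1).
Proof. by rewrite /coord_frame (unsplitK (inr j)). Qed.

Lemma coord_frame_span (v : 'rV[R]_m * R) :
  exists c : 'I_(m + 1) -> R, v = \sum_i c i *: coord_frame R i.
Proof.
case: v => x s; exists (fun i => row_mx x (\row__ s) 0 i).
rewrite big_split_ord big_ord1 /= coord_frame_rshift row_mxEr mxE.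
under eq_bigr do rewrite row_mxEl coord_frame_lshift.
have -> : \sum_(i < m) x 0 i *: ((delta_mx 0 i, 0) : 'rV[R]_m * R) = (x, 0).
  rewrite {2}[x]row_sum_delta.
  elim/big_ind2 : _ => [//|a b c d|j _]; last by congr pair; exact: scaler0.
  by move=> -> ->; congr pair; exact: addr0.
congr pair; first by rewrite /= scaler0 addr0.
by rewrite /= /GRing.scale /= mulr1 add0r.
Qed.

Hypothesis unit_metric : induced_metric f p \in unitmx.

Let e i := 'd f p (coord_frame R i).

(** The tangential part of w is the combination of the e_i with coefficients
    g^(ji) <w, e_j>. *)
Lemma normal_partP (w : RCn R (m + 1)) :
  normal_fiber f p (normal_part f p w) /\
  tangent_space f p (w - normal_part f p w).
Proof.
pose G := induced_metric f p.
pose c i := \sum_j edot w (e j) * invmx G j i.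
pose t := \sum_i c i *: e i.
have tt : tangent_space f p t.
  exists (\sum_i c i *: coord_frame R i) => //.
  by rewrite linear_sum; apply: eq_bigr => i _; rewrite linearZ.
have te k : edot t (e k) = edot w (e k).
  rewrite edotC linear_sum /=.
  transitivity (\sum_i \sum_j edot w (e j) * (invmx G j i * G i k)).
    apply: eq_bigr => i _; rewrite linearZ /= /c /GRing.scale /= mulr_suml.
    by apply: eq_bigr => j _; rewrite /G mxE [edot (e k) _]edotC mulrA.
  rewrite exchange_big /=.
  transitivity (\sum_j edot w (e j) * (1%:M : 'M[R]_(m + 1)) j k).
    apply: eq_bigr => j _; rewrite -mulr_sumr; congr (_ * _).
    by rewrite -(mulVmx unit_metric) mxE.
  rewrite (bigD1 k) //= mxE eqxx mulr1 big1 ?addr0 // => j jk.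
  by rewrite mxE (negPf jk) mulr0.
clearbody t; have nw : normal_fiber f p (w - t).
  move=> _ [v _ <-]; have [d ->] := coord_frame_span v.
  rewrite linear_sum /= linear_sum /= big1 // => k _.
  by rewrite !linearZ /= edotC linearB /= ![edot (e k) _]edotC te subrr scaler0.
have tw : tangent_space f p (w - (w - t)) by rewrite opprB addrC subrK.
by rewrite (normal_part_unique nw tw).
Qed.

Lemma normal_part_linear : linear (normal_part f p).
Proof.
move=> c z w; apply: normal_part_unique.
  have [nz _] := normal_partP z; have [nw _] := normal_partP w.
  by move=> t tt; rewrite edotC linearP /= ![edot t _]edotC nz // nw // scaler0 addr0.
have [_ tz] := normal_partP z; have [_ tw] := normal_partP w.
have -> : c *: z + w - (c *: normal_part f p z + normal_part f p w) =
   c *: (z - normal_part f p z) + (w - normal_part f p w).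
  by rewrite scalerBr opprD addrACA.
exact: tangent_space_linear.
Qed.

(** H is the normal part of the metric trace of the second derivative of f. *)
Lemma mean_curvatureE :
  mean_curvature f p = normal_part f p (\sum_i \sum_j
    invmx (induced_metric f p) i j *:
      'D_(coord_frame R i) ('D_(coord_frame R j) f) p).
Proof.
pose L : {linear RCn R (m + 1) -> RCn R (m + 1)} := HB.pack (normal_part f p)
  (GRing.isLinear.Build _ _ _ _ _ normal_part_linear).
rewrite /mean_curvature [RHS](linear_sum L); apply: eq_bigr => i _.
rewrite (linear_sum L); apply: eq_bigr => j _.
by rewrite (linearZ_LR L).
Qed.

End mean_curvature.

(** * The functions of one variable *)

Lemma is_derive_mul (R : realType) (V : normedModType R) (f g : V -> R)
    (p v : V) (df dg : R) :
  is_derive p v f df -> is_derive p v g dg ->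
  is_derive p v (fun q => f q * g q) (f p * dg + g p * df).
Proof. by move=> hf hg; exact: is_deriveM. Qed.

Lemma is_derive_add (R : realType) (V : normedModType R) (f g : V -> R)
    (p v : V) (df dg : R) :
  is_derive p v f df -> is_derive p v g dg ->
  is_derive p v (fun q => f q + g q) (df + dg).
Proof. by move=> hf hg; exact: is_deriveD. Qed.

Lemma is_derive_scale (R : realType) (V : normedModType R) (c : R) (f : V -> R)
    (p v : V) (df : R) :
  is_derive p v f df -> is_derive p v (fun q => c * f q) (c * df).
Proof. by move=> hf; exact: is_deriveZ. Qed.

Lemma is_derive_chain (R : realType) (h g : R -> R) (t dh dg : R) :
  is_derive (g t) 1 h dh -> is_derive t 1 g dg ->
  is_derive t 1 (fun u => h (g u)) (dh * dg).
Proof. by move=> hh hg; exact: is_derive1_comp. Qed.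

Lemma is_derive_inv (R : realType) (g : R -> R) (t dg : R) : g t != 0 ->
  is_derive t 1 g dg -> is_derive t 1 (fun u => (g u)^-1) (- (g t ^+ 2)^-1 * dg).
Proof. by move=> g0 hg; exact: is_deriveV. Qed.

Lemma is_derive_sqr (R : realType) (t : R) :
  is_derive t 1 (fun u : R => u ^+ 2) (2 * t).
Proof.
have := is_derive_mul (is_derive_id t 1) (is_derive_id t 1).
by rewrite mulr1 -mulr2n mulr_natl.
Qed.

Section profile.
Variables (R : realType) (m : nat) (a psi : 'I_m -> R) (E alpha : R).
Hypotheses (a_gt0 : forall j, 0 < a j) (E_gt1 : 1 < E) (alpha_ge0 : 0 <= alpha).

Local Notation r := (rfun a).
Local Notation D := (denom a E alpha).
Local Notation Phi := (phi a psi E alpha).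

(** What the square root [denom] is taken of is [radicand t - 1]. *)
Definition radicand (t : R) : R :=
  E * (\prod_(k < m) (1 + a k * t ^+ 2)) * expR (alpha * t ^+ 2).

(** The imaginary part of w = s + i nu, where d_s L is w times the vector V. *)
Definition nu (t : R) : R := `|t| / D t.

(** The imaginary part of the last coordinate of L. *)
Definition theta (t : R) : R := int0 nu t.

(** The logarithmic derivative of [radicand], divided by 2 t. *)
Definition kappa (t : R) : R := \sum_k (r k t ^+ 2)^-1 + alpha.

(** The derivative of [nu] at t <> 0. *)
Definition dnu (t : R) : R := nu t / t * (1 - (t ^+ 2 + nu t ^+ 2) * kappa t).

Lemma rfun_sqr j t : r j t ^+ 2 = (a j)^-1 + t ^+ 2.
Proof. by rewrite sqr_sqrtr // addr_ge0 ?sqr_ge0 // invr_ge0 ltW. Qed.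

Lemma rfun_gt0 j t : 0 < r j t.
Proof. by rewrite sqrtr_gt0 ltr_wpDr ?sqr_ge0 // invr_gt0. Qed.

Lemma rfun_neq0 j t : r j t != 0.
Proof. by rewrite gt_eqF // rfun_gt0. Qed.

Lemma radicand_gt1 t : 1 < radicand t.
Proof.
have prod_ge1 : 1 <= \prod_(k < m) (1 + a k * t ^+ 2).
  elim/big_ind : _ => [//|x y x1 y1|k _].
    exact: mulr_ege1.
  by rewrite lerDl mulr_ge0 ?sqr_ge0 // ltW.
have exp_ge1 : 1 <= expR (alpha * t ^+ 2).
  by rewrite -expR0 ler_expR mulr_ge0 ?sqr_ge0.
rewrite /radicand -mulrA; apply: lt_le_trans E_gt1 _.
by rewrite ler_peMr ?mulr_ege1 // ltW // (lt_trans _ E_gt1).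
Qed.

Lemma denom_gt0 t : 0 < D t.
Proof. by rewrite sqrtr_gt0 subr_gt0 radicand_gt1. Qed.

Lemma denom_neq0 t : D t != 0.
Proof. by rewrite gt_eqF // denom_gt0. Qed.

Lemma denom_sqr t : D t ^+ 2 = radicand t - 1.
Proof. by rewrite sqr_sqrtr // subr_ge0 ltW // radicand_gt1. Qed.

Lemma nu_neq0 t : t != 0 -> nu t != 0.
Proof. by move=> t0; rewrite mulf_neq0 ?invr_eq0 ?normr_eq0 ?denom_neq0. Qed.

(** The angular speed of the j-th circle is nu / r_j^2. *)
Lemma phiE j t : Phi j t = psi j + int0 (fun t => nu t / r j t ^+ 2) t.
Proof.
rewrite /phi; congr (_ + int0 _ _); apply/funext => u.
by rewrite /nu rfun_sqr invfM mulrA mulrAC.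
Qed.


Let B := [set t : R | t != 0].

Let oB : open B.
Proof. exact: open_neq. Qed.

Lemma Ck_on_sqrn k (A : set R) : open A -> Ck_on k A (fun t : R => t ^+ 2).
Proof. by move=> oA; apply: Ck_onM => //; exact: Ck_on_id. Qed.

Lemma Ck_on_radicand k : Ck_on k setT radicand.
Proof.
have oT : open [set: R] by exact: openT.
apply: Ck_onM => //.
  apply: Ck_onM; [by []|exact: Ck_on_cst|].
  apply: Ck_on_prod => // j; apply: Ck_onD; [by []|exact: Ck_on_cst|].
  by apply: Ck_onM => //; [exact: Ck_on_cst|exact: Ck_on_sqrn].
apply: (@Ck_on_comp _ _ _ _ setT (fun t : R => alpha * t ^+ 2) (@expR R)) => //.
  by apply: Ck_onM => //; [exact: Ck_on_cst|exact: Ck_on_sqrn].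
exact: Ck_on_expR.
Qed.

Lemma Ck_on_denom k : Ck_on k setT D.
Proof.
have oT : open [set: R] by exact: openT.
apply: (@Ck_on_comp _ _ _ _ [set t | 0 < t] (fun t => radicand t - 1) Num.sqrt) => //.
- by move=> t _ /=; rewrite subr_gt0 radicand_gt1.
- by apply: Ck_onD => //; [exact: Ck_on_radicand|exact: Ck_on_cst].
- exact: Ck_on_sqrt.
Qed.

Lemma Ck_on_denomV k : Ck_on k setT (fun t => (D t)^-1).
Proof.
apply: (@Ck_on_comp _ _ _ _ [set t : R | t != 0] D GRing.inv).
- exact: openT.
- by move=> t _; exact: denom_neq0.
- exact: Ck_on_denom.
- exact: Ck_on_inv.
Qed.

Lemma Ck_on_rfun k j : Ck_on k setT (r j).
Proof.
have oT : open [set: R] by exact: openT.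
apply: (@Ck_on_comp _ _ _ _ [set t | 0 < t] (fun t : R => (a j)^-1 + t ^+ 2) Num.sqrt) => //.
- by move=> t _ /=; rewrite ltr_wpDr ?sqr_ge0 // invr_gt0.
- by apply: Ck_onD => //; [exact: Ck_on_cst|exact: Ck_on_sqrn].
- exact: Ck_on_sqrt.
Qed.

Lemma Ck_on_rfunV k j : Ck_on k setT (fun t => (r j t)^-1).
Proof.
apply: (@Ck_on_comp _ _ _ _ [set t : R | t != 0] (r j) GRing.inv).
- exact: openT.
- by move=> t _; exact: rfun_neq0.
- exact: Ck_on_rfun.
- exact: Ck_on_inv.
Qed.

Lemma Ck_on_nu k : Ck_on k B nu.
Proof.
apply: Ck_onM => //; first exact: Ck_on_normr.
exact: Ck_on_sub (Ck_on_denomV k).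
Qed.

Lemma continuous_nu : continuous nu.
Proof.
move=> t; apply: continuousM; first exact: norm_continuous.
exact: (Ck_on_denomV 0).
Qed.

Lemma continuous_nu_rfun j : continuous (fun t => nu t / r j t ^+ 2).
Proof.
move=> t; apply: continuousM; first exact: continuous_nu.
have -> : (fun u => (r j u ^+ 2)^-1) = (fun u => (r j u)^-1 * (r j u)^-1).
  by apply/funext => u; rewrite -invfM expr2.
have cr : {for t, continuous (fun u => (r j u)^-1)} by exact: (Ck_on_rfunV 0 j).
exact: continuousM.
Qed.

Lemma is_derive_theta (t : R) : is_derive t 1 theta (nu t).
Proof. exact/is_derive_int0/continuous_nu. Qed.

Lemma is_derive_phi j (t : R) : is_derive t 1 (Phi j) (nu t / r j t ^+ 2).
Proof.
have hi := is_derive_int0 t (continuous_nu_rfun (j := j)).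
have -> : Phi j = cst (psi j) + int0 (fun t => nu t / r j t ^+ 2).
  by apply/funext => u; rewrite phiE.
rewrite -[X in is_derive _ _ _ X]add0r; exact: is_deriveD.
Qed.

Lemma Ck_on_theta k : Ck_on k B theta.
Proof.
by apply: Ck_onW; apply: Ck_on_is_derive (Ck_on_nu k) => // t _; exact: is_derive_theta.
Qed.

Lemma Ck_on_phi k j : Ck_on k B (Phi j).
Proof.
apply: Ck_onW; apply: (@Ck_on_is_derive _ _ _ _ (fun t => nu t / r j t ^+ 2)) => //.
  by move=> t _; exact: is_derive_phi.
have -> : (fun t => nu t / r j t ^+ 2) = (fun t => nu t * ((r j t)^-1 * (r j t)^-1)).
  by apply/funext => u; rewrite -invfM expr2.
apply: Ck_onM => //; first exact: Ck_on_nu.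
apply: (@Ck_on_sub _ _ _ _ _ setT) => //.
by apply: Ck_onM; [exact: openT|exact: Ck_on_rfunV|exact: Ck_on_rfunV].
Qed.

Lemma Ck_on_cos_phi k j : Ck_on k B (fun t => cos (Phi j t)).
Proof.
have [_ Cc] := Ck_on_sin_cos R k.
by apply: (@Ck_on_comp _ _ _ _ setT (Phi j) cos) => //; exact: Ck_on_phi.
Qed.

Lemma Ck_on_sin_phi k j : Ck_on k B (fun t => sin (Phi j t)).
Proof.
have [Cs _] := Ck_on_sin_cos R k.
by apply: (@Ck_on_comp _ _ _ _ setT (Phi j) sin) => //; exact: Ck_on_phi.
Qed.


Lemma is_derive_rfun j (t : R) : is_derive t 1 (r j) (t / r j t).
Proof.
have r0 : 0 < (a j)^-1 + t ^+ 2 by rewrite ltr_wpDr ?sqr_ge0 // invr_gt0.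
have hs := is_derive_add (is_derive_cst (a j)^-1 t 1) (is_derive_sqr t).
have := is_derive_chain (g := fun u => (a j)^-1 + u ^+ 2) (is_derive1_sqrt r0) hs.
rewrite add0r -[Num.sqrt _]/(r j t) => h; apply: is_derive_eq h _.
by field; exact: rfun_neq0.
Qed.

Lemma is_derive_rfunV j (t : R) :
  is_derive t 1 (fun u => (r j u)^-1) (- (t / r j t ^+ 3)).
Proof.
have := is_derive_inv (rfun_neq0 j t) (is_derive_rfun j t).
move=> h; apply: is_derive_eq h _.
by field; exact: rfun_neq0.
Qed.

(** The logarithmic derivative of 1 + a_k t^2 is 2 t / r_k^2, since
    1 + a_k t^2 = a_k r_k^2. *)
Lemma is_derive_prod (s : seq 'I_m) (t : R) :
  is_derive t 1 (fun u : R => \prod_(k <- s) (1 + a k * u ^+ 2))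
    ((\prod_(k <- s) (1 + a k * t ^+ 2)) * \sum_(k <- s) 2 * t / r k t ^+ 2).
Proof.
elim: s => [|k s IH].
  rewrite !big_nil mulr0; under eq_fun do rewrite big_nil.
  exact: is_derive_cst.
rewrite !big_cons; under eq_fun do rewrite big_cons.
have hk := is_derive_add (is_derive_cst (1 : R) t 1)
             (is_derive_scale (a k) (is_derive_sqr t)).
apply: is_derive_eq (is_derive_mul hk IH) _.
have -> : r k t ^+ 2 = (1 + a k * t ^+ 2) / a k.
  by rewrite rfun_sqr; field; rewrite gt_eqF.
rewrite /cst /=; field.
by rewrite gt_eqF //= gt_eqF // ltr_wpDr // mulr_ge0 ?sqr_ge0 // ltW.
Qed.

Lemma is_derive_radicand (t : R) :
  is_derive t 1 radicand (radicand t * (2 * t * kappa t)).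
Proof.
have hp := is_derive_scale E (is_derive_prod (index_enum _) t).
have he := is_derive_chain (g := fun u => alpha * u ^+ 2)
             (is_derive_expR (alpha * t ^+ 2))
             (is_derive_scale alpha (is_derive_sqr t)).
apply: is_derive_eq (is_derive_mul hp he) _.
rewrite /radicand /kappa -mulr_sumr.
ring.
Qed.

Lemma is_derive_denom (t : R) :
  is_derive t 1 D (t * (D t ^+ 2 + 1) * kappa t / D t).
Proof.
have R0 : 0 < radicand t - 1 by rewrite subr_gt0 radicand_gt1.
have hs := is_derive_add (is_derive_radicand t) (is_derive_cst (-1 : R) t 1).
have := is_derive_chain (g := fun u => radicand u - 1) (is_derive1_sqrt R0) hs.
rewrite -[Num.sqrt _]/(D t) => h; apply: is_derive_eq h _.
by rewrite denom_sqr; field; exact: denom_neq0.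
Qed.

Lemma is_derive_nu (t : R) : t != 0 -> is_derive t 1 nu (dnu t).
Proof.
move=> t0.
have hD := is_derive_inv (denom_neq0 t) (is_derive_denom t).
apply: is_derive_eq (is_derive_mul (is_derive_normr t0) hD) _.
have -> : Num.sg t = `|t| / t by rewrite [in RHS]normrEsg mulfK.
rewrite /dnu /nu expr_div_n real_normK ?num_real //.
by field; rewrite t0 denom_neq0.
Qed.

Lemma is_derive_cos_phi j (t : R) :
  is_derive t 1 (fun u => cos (Phi j u)) (- sin (Phi j t) * (nu t / r j t ^+ 2)).
Proof. exact: is_derive_chain (is_derive_cos _) (is_derive_phi j t). Qed.

Lemma is_derive_sin_phi j (t : R) :
  is_derive t 1 (fun u => sin (Phi j u)) (cos (Phi j t) * (nu t / r j t ^+ 2)).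
Proof. exact: is_derive_chain (is_derive_sin _) (is_derive_phi j t). Qed.

End profile.

(** * The parametrization and its derivatives *)

Section domain.
Variables (R : realType) (m : nat).
Local Notation V := ('rV[R]_m * R)%type.

(** The coordinates x_j and s of the domain, as linear forms. *)
Definition xcoord (j : 'I_m) (p : V) : R := p.1 0 j.

Fact xcoord_linear j : linear (xcoord j).
Proof. by move=> c z w; rewrite /xcoord /= !mxE. Qed.
HB.instance Definition _ j :=
  GRing.isLinear.Build R V R _ (xcoord j) (xcoord_linear j).

Lemma xcoord_continuous j : continuous (xcoord j).
Proof.
move=> z; apply: (@continuous_comp _ _ _ fst (fun u : 'rV[R]_m => u 0 j)).
  exact: cvg_fst.
exact: coord_continuous.
Qed.

Definition height (p : V) : R := p.2.

Fact height_linear : linear height.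
Proof. by []. Qed.
HB.instance Definition _ :=
  GRing.isLinear.Build R V R _ height height_linear.

Lemma height_continuous : continuous height.
Proof. by move=> z; exact: cvg_snd. Qed.

Lemma Ldomain_open : open (Ldomain R m).
Proof.
have -> : Ldomain R m = height @^-1` [set s | s != 0].
  by apply/seteqP; split => -[x s] //= [].
by apply: open_comp => [z _|]; [exact: height_continuous|exact: open_neq].
Qed.

Lemma is_derive_linear (f : {linear V -> R}) (p v : V) : continuous f ->
  is_derive p v f (f v).
Proof.
move=> cf; have df : differentiable f p by exact: linear_differentiable.
apply: DeriveDef; first exact: diff_derivable.
by rewrite deriveE // diff_lin.
Qed.

Lemma is_derive_height (h : R -> R) (dh : R) (p v : V) :
  is_derive p.2 1 h dh -> is_derive p v (fun q : V => h q.2) (dh * v.2).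
Proof.
move=> [dh1 <-].
have ds : differentiable height p.
  by apply: linear_differentiable; exact: height_continuous.
have dhs : differentiable h (height p) by exact/derivable1_diffP.
apply: DeriveDef; first exact/diff_derivable/(differentiable_comp ds dhs).
have [_ <-] := is_derive_linear p v height_continuous.
exact: derive_scalar_comp.
Qed.

(** The derivative of an expression that is affine in the j-th variable. *)
Lemma is_derive_affine (F G : R -> R) (dF dG : R) (j : 'I_m) (p v : V) :
  is_derive p.2 1 F dF -> is_derive p.2 1 G dG ->
  is_derive p v (fun q : V => q.1 0 j * F q.2 + G q.2)
    (v.1 0 j * F p.2 + p.1 0 j * (dF * v.2) + dG * v.2).
Proof.
move=> hF hG.
have hM := is_derive_mul (is_derive_linear p v (xcoord_continuous (j := j)))
             (is_derive_height v hF).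
apply: is_derive_eq (is_derive_add hM (is_derive_height v hG)) _.
by rewrite /= /xcoord; ring.
Qed.

Lemma Ck_on_height k (h : R -> R) : Ck_on k [set s : R | s != 0] h ->
  Ck_on k (Ldomain R m) (fun p => h p.2).
Proof.
apply: (@Ck_on_comp _ _ _ _ _ height h); first exact: Ldomain_open.
  by move=> p [].
by apply: Ck_on_linear; exact: height_continuous.
Qed.

Lemma Ck_on_xcoord k j : Ck_on k (Ldomain R m) (fun p => p.1 0 j).
Proof. by apply: (@Ck_on_linear _ _ _ _ _ (xcoord j)); exact: xcoord_continuous. Qed.

End domain.

Section parametrization.
Variables (R : realType) (m : nat) (a psi : 'I_m -> R) (E alpha : R).
Hypotheses (a_gt0 : forall j, 0 < a j) (E_gt1 : 1 < E) (alpha_ge0 : 0 <= alpha).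

Local Notation V := ('rV[R]_m * R)%type.
Local Notation r := (rfun a).
Local Notation Phi := (phi a psi E alpha).
Local Notation nu := (nu a E alpha).
Local Notation dnu := (dnu a E alpha).
Local Notation theta := (theta a E alpha).
Local Notation L := (Lparam a psi E alpha).
Local Notation dom := (Ldomain R m).

(** The vector with coordinates (A_j + i B_j) e^(i phi_j) and c + i d. *)
Definition rotv (t : R) (A B : 'I_m -> R) (c d : R) : RCn R (m + 1) :=
  (row_mx (\row_j (cos (Phi j t) * A j - sin (Phi j t) * B j)) (\row__ c),
   row_mx (\row_j (sin (Phi j t) * A j + cos (Phi j t) * B j)) (\row__ d)).

Lemma re_rotv_l t A B c d j : re_part (lshift 1 j) (rotv t A B c d) =
  cos (Phi j t) * A j - sin (Phi j t) * B j.
Proof. by rewrite /re_part row_mxEl mxE. Qed.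

Lemma im_rotv_l t A B c d j : im_part (lshift 1 j) (rotv t A B c d) =
  sin (Phi j t) * A j + cos (Phi j t) * B j.
Proof. by rewrite /im_part row_mxEl mxE. Qed.

Lemma re_rotv_r t A B c d j : re_part (rshift m j) (rotv t A B c d) = c.
Proof. by rewrite /re_part row_mxEr mxE. Qed.

Lemma im_rotv_r t A B c d j : im_part (rshift m j) (rotv t A B c d) = d.
Proof. by rewrite /im_part row_mxEr mxE. Qed.

Definition rotvE := (re_rotv_l, im_rotv_l, re_rotv_r, im_rotv_r).

Lemma edot_rotv t A B c d A' B' c' d' :
  edot (rotv t A B c d) (rotv t A' B' c' d') =
  \sum_j (A j * A' j + B j * B' j) + (c * c' + d * d').
Proof.
rewrite edotE big_split_ord big_ord1 /= !rotvE; congr (_ + _).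
apply: eq_bigr => j _; rewrite !rotvE.
transitivity ((cos (Phi j t) ^+ 2 + sin (Phi j t) ^+ 2) *
  (A j * A' j + B j * B' j)).
  by ring.
by rewrite cos2Dsin2 mul1r.
Qed.

Lemma omega_rotv t A B c d A' B' c' d' :
  omega (rotv t A B c d) (rotv t A' B' c' d') =
  \sum_j (A j * B' j - B j * A' j) + (c * d' - d * c').
Proof.
transitivity (\sum_k (re_part k (rotv t A B c d) * im_part k (rotv t A' B' c' d') -
  im_part k (rotv t A B c d) * re_part k (rotv t A' B' c' d'))) => //.
rewrite big_split_ord big_ord1 /= !rotvE; congr (_ + _).
apply: eq_bigr => j _; rewrite !rotvE.
transitivity ((cos (Phi j t) ^+ 2 + sin (Phi j t) ^+ 2) *
  (A j * B' j - B j * A' j)).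
  by ring.
by rewrite cos2Dsin2 mul1r.
Qed.

(** The differential of the parametrization: with w = s + i nu, its value at v
    has coordinates e^(i phi_j) (r_j v_j + x_j w v_s / r_j) and
    - sum_j x_j v_j + w v_s. *)
Definition dL (v p : V) : RCn R (m + 1) :=
  rotv p.2 (fun j => r j p.2 * v.1 0 j + p.1 0 j / r j p.2 * p.2 * v.2)
          (fun j => p.1 0 j / r j p.2 * nu p.2 * v.2)
          (- (\sum_j p.1 0 j * v.1 0 j) + p.2 * v.2) (nu p.2 * v.2).

(** The second derivative: e^(i phi_j) ((w / r_j) (v_s u_j + v_j u_s) +
    x_j (w' / r_j - |w|^2 / r_j^3) v_s u_s) and - sum_j v_j u_j + w' v_s u_s. *)
Definition ddL (v u p : V) : RCn R (m + 1) :=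
  rotv p.2
    (fun j => p.2 / r j p.2 * (v.2 * u.1 0 j + v.1 0 j * u.2) +
       p.1 0 j * ((r j p.2)^-1 - (p.2 ^+ 2 + nu p.2 ^+ 2) / r j p.2 ^+ 3) *
         (v.2 * u.2))
    (fun j => nu p.2 / r j p.2 * (v.2 * u.1 0 j + v.1 0 j * u.2) +
       p.1 0 j * (dnu p.2 / r j p.2) * (v.2 * u.2))
    (- (\sum_j v.1 0 j * u.1 0 j) + v.2 * u.2) (dnu p.2 * (v.2 * u.2)).

Lemma re_Lparam_l j p :
  re_part (lshift 1 j) (L p) = p.1 0 j * (r j p.2 * cos (Phi j p.2)).
Proof. by rewrite /re_part /= !mxE (unsplitK (inl j)) !mxE /=; ring. Qed.

Lemma im_Lparam_l j p :
  im_part (lshift 1 j) (L p) = p.1 0 j * (r j p.2 * sin (Phi j p.2)).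
Proof. by rewrite /im_part /= !mxE (unsplitK (inl j)) !mxE /=; ring. Qed.

Lemma re_Lparam_r (j : 'I_1) p : re_part (rshift m j) (L p) =
  - (1 / 2) * (\sum_j p.1 0 j ^+ 2) + 1 / 2 * p.2 ^+ 2.
Proof. by rewrite /re_part /= !mxE (unsplitK (inr j)) !mxE. Qed.

Lemma im_Lparam_r (j : 'I_1) p : im_part (rshift m j) (L p) = theta p.2.
Proof. by rewrite /im_part /= !mxE (unsplitK (inr j)) !mxE. Qed.

Lemma smooth_Lparam : smooth_on dom L.
Proof.
have oD := @Ldomain_open R m; split => // k.
apply: Ck_on_parts => // i; case: (split_ordP i) => j ->.
- under eq_fun do rewrite re_Lparam_l.
  apply: Ck_onM => //; first exact: Ck_on_xcoord.
  apply: (@Ck_on_height _ _ _ (fun t => r j t * cos (Phi j t))).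
  apply: Ck_onM; [exact: open_neq| |exact: Ck_on_cos_phi].
  by apply: Ck_on_sub (Ck_on_rfun _ _ _).
- under eq_fun do rewrite re_Lparam_r.
  apply: Ck_onD => //; apply: Ck_onM => //; try exact: Ck_on_cst.
    apply: Ck_on_sum => // l.
    by apply: Ck_onM => //; exact: Ck_on_xcoord.
  apply: (@Ck_on_height _ _ _ (fun t => t ^+ 2)).
  by apply: Ck_on_sqrn; exact: open_neq.
- under eq_fun do rewrite im_Lparam_l.
  apply: Ck_onM => //; first exact: Ck_on_xcoord.
  apply: (@Ck_on_height _ _ _ (fun t => r j t * sin (Phi j t))).
  apply: Ck_onM; [exact: open_neq| |exact: Ck_on_sin_phi].
  by apply: Ck_on_sub (Ck_on_rfun _ _ _).
- under eq_fun do rewrite im_Lparam_r.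
  by apply: Ck_on_height; exact: Ck_on_theta.
Qed.


Lemma is_derive_big_sum (I : Type) (s : seq I) (f : I -> V -> R)
    (p v : V) (df : I -> R) :
  (forall i, is_derive p v (f i) (df i)) ->
  is_derive p v (fun q => \sum_(i <- s) f i q) (\sum_(i <- s) df i).
Proof.
move=> hf; elim: s => [|i s IH].
  by rewrite big_nil; under eq_fun do rewrite big_nil; exact: is_derive_cst.
by rewrite big_cons; under eq_fun do rewrite big_cons; exact: is_derive_add.
Qed.

Lemma is_derive_xcoord j (p v : V) :
  is_derive p v (fun q : V => q.1 0 j) (v.1 0 j).
Proof. exact: is_derive_linear (xcoord_continuous (j := j)). Qed.

Lemma re_Lparam_derive i (p v : V) : p.2 != 0 ->
  is_derive p v (fun q => re_part i (L q)) (re_part i (dL v p)).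
Proof.
move=> p0; case: (split_ordP i) => j ->.
  under eq_fun do rewrite re_Lparam_l.
  have hF := is_derive_mul (is_derive_rfun a_gt0 j p.2)
    (is_derive_cos_phi psi a_gt0 E_gt1 alpha_ge0 j p.2).
  apply: is_derive_eq (is_derive_mul (is_derive_xcoord j p v) (is_derive_height v hF)) _.
  by rewrite rotvE; field; exact: rfun_neq0.
under eq_fun do rewrite re_Lparam_r.
have hs := is_derive_big_sum (index_enum _) (fun l : 'I_m =>
  is_derive_mul (is_derive_xcoord l p v) (is_derive_xcoord l p v)).
have h2 := is_derive_scale (1 / 2) (is_derive_height v (is_derive_sqr p.2)).
apply: is_derive_eq (is_derive_add (is_derive_scale (- (1 / 2)) hs) h2) _.
by rewrite rotvE big_split /=; field.
Qed.

Lemma im_Lparam_derive i (p v : V) : p.2 != 0 ->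
  is_derive p v (fun q => im_part i (L q)) (im_part i (dL v p)).
Proof.
move=> p0; case: (split_ordP i) => j ->.
  under eq_fun do rewrite im_Lparam_l.
  have hF := is_derive_mul (is_derive_rfun a_gt0 j p.2)
    (is_derive_sin_phi psi a_gt0 E_gt1 alpha_ge0 j p.2).
  apply: is_derive_eq (is_derive_mul (is_derive_xcoord j p v) (is_derive_height v hF)) _.
  by rewrite rotvE; field; exact: rfun_neq0.
under eq_fun do rewrite im_Lparam_r.
by rewrite rotvE; apply: is_derive_height; exact: is_derive_theta.
Qed.

Lemma re_dL_derive i (p v u : V) : p.2 != 0 ->
  is_derive p v (fun q => re_part i (dL u q)) (re_part i (ddL v u p)).
Proof.
move=> p0; case: (split_ordP i) => j ->.
  have hc := is_derive_cos_phi psi a_gt0 E_gt1 alpha_ge0 j p.2.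
  have hs := is_derive_sin_phi psi a_gt0 E_gt1 alpha_ge0 j p.2.
  have hr := is_derive_rfun a_gt0 j p.2.
  have hV := is_derive_rfunV a_gt0 j p.2.
  have hn := is_derive_nu a_gt0 E_gt1 alpha_ge0 p0.
  have hF := is_derive_scale u.2 (is_derive_mul hV (is_derive_add
    (is_derive_mul hc (is_derive_id p.2 1))
    (is_derive_scale (-1) (is_derive_mul hs hn)))).
  have hG := is_derive_scale (u.1 0 j) (is_derive_mul hr hc).
  have -> : (fun q => re_part (lshift 1 j) (dL u q)) = (fun q : V =>
      q.1 0 j * (u.2 * ((r j q.2)^-1 *
        (cos (Phi j q.2) * q.2 + -1 * (sin (Phi j q.2) * nu q.2)))) +
      u.1 0 j * (r j q.2 * cos (Phi j q.2))).
    by apply/funext => q; rewrite rotvE; ring.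
  apply: is_derive_eq (is_derive_affine j v hF hG) _.
  by rewrite rotvE; field; exact: rfun_neq0.
have hs := is_derive_big_sum (index_enum _) (fun l : 'I_m =>
  is_derive_mul (is_derive_xcoord l p v) (is_derive_cst (u.1 0 l : R) p v)).
have h2 := is_derive_height v (is_derive_mul (is_derive_id p.2 1) (is_derive_cst (u.2 : R) p.2 1)).
under eq_fun do rewrite rotvE -mulN1r.
apply: is_derive_eq (is_derive_add (is_derive_scale (-1) hs) h2) _.
rewrite rotvE mulN1r; congr (- _ + _); last by rewrite /cst /=; ring.
by apply: eq_bigr => l _; rewrite /cst /=; ring.
Qed.

Lemma im_dL_derive i (p v u : V) : p.2 != 0 ->
  is_derive p v (fun q => im_part i (dL u q)) (im_part i (ddL v u p)).
Proof.
move=> p0; have hn := is_derive_nu a_gt0 E_gt1 alpha_ge0 p0.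
case: (split_ordP i) => j ->.
  have hc := is_derive_cos_phi psi a_gt0 E_gt1 alpha_ge0 j p.2.
  have hs := is_derive_sin_phi psi a_gt0 E_gt1 alpha_ge0 j p.2.
  have hr := is_derive_rfun a_gt0 j p.2.
  have hV := is_derive_rfunV a_gt0 j p.2.
  have hF := is_derive_scale u.2 (is_derive_mul hV (is_derive_add
    (is_derive_mul hs (is_derive_id p.2 1)) (is_derive_mul hc hn))).
  have hG := is_derive_scale (u.1 0 j) (is_derive_mul hr hs).
  have -> : (fun q => im_part (lshift 1 j) (dL u q)) = (fun q : V =>
      q.1 0 j * (u.2 * ((r j q.2)^-1 *
        (sin (Phi j q.2) * q.2 + cos (Phi j q.2) * nu q.2))) +
      u.1 0 j * (r j q.2 * sin (Phi j q.2))).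
    by apply/funext => q; rewrite rotvE; ring.
  apply: is_derive_eq (is_derive_affine j v hF hG) _.
  by rewrite rotvE; field; exact: rfun_neq0.
under eq_fun do rewrite rotvE.
have h := is_derive_height v (is_derive_mul hn (is_derive_cst (u.2 : R) p.2 1)).
by apply: is_derive_eq h _; rewrite rotvE /cst /=; ring.
Qed.

(** Directional derivatives can be computed on the real and imaginary parts of
    the coordinates. *)
Lemma derive_parts (f : V -> RCn R (m + 1)) (p v : V) (w : RCn R (m + 1)) :
  differentiable f p ->
  (forall i, is_derive p v (fun q => re_part i (f q)) (re_part i w)) ->
  (forall i, is_derive p v (fun q => im_part i (f q)) (im_part i w)) ->
  'D_v f p = w.
Proof.
move=> df hre him; apply: RCnP => i.
  rewrite -(derive_linear_comp v (re_part_continuous (k := i)) df).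
  by have [_ <-] := hre i.
rewrite -(derive_linear_comp v (im_part_continuous (k := i)) df).
by have [_ <-] := him i.
Qed.

Lemma derive_Lparam (p v : V) : dom p -> 'D_v L p = dL v p.
Proof.
move=> Dp; have [_ CL] := smooth_Lparam; have [dL1 _] := CL 1%N.
have p0 : p.2 != 0 by case: Dp.
apply: derive_parts; first exact: dL1.
  by move=> i; exact: re_Lparam_derive.
by move=> i; exact: im_Lparam_derive.
Qed.

Lemma diff_Lparam (p v : V) : dom p -> 'd L p v = dL v p.
Proof.
move=> Dp; have [_ CL] := smooth_Lparam; have [dL1 _] := CL 1%N.
by rewrite -deriveE ?derive_Lparam //; exact: dL1.
Qed.

Lemma derive2_Lparam (p v u : V) : dom p -> 'D_v ('D_u L) p = ddL v u p.
Proof.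
move=> Dp; have [oD CL] := smooth_Lparam.
have [_ /(_ u)[dL2 _]] := CL 2%N.
have p0 : p.2 != 0 by case: Dp.
have near_dL : \near p, dL u p = 'D_u L p.
  apply: filterS (open_nbhs_nbhs (conj oD Dp)) => q Dq.
  by rewrite derive_Lparam.
apply: derive_parts; first exact: dL2.
  move=> i; apply: near_eq_is_derive (re_dL_derive i v u p0).
  by apply: filterS near_dL => q ->.
move=> i; apply: near_eq_is_derive (im_dL_derive i v u p0).
by apply: filterS near_dL => q ->.
Qed.

End parametrization.

(** * The metric and the mean curvature of L *)

Section swap.
Variables (R : realType) (V W : normedModType R).

Definition swap (p : V * W) : W * V := (p.2, p.1).

Fact swap_linear : linear swap.
Proof. by []. Qed.
HB.instance Definition _ :=
  GRing.isLinear.Build R (V * W)%type (W * V)%type _ swap swap_linear.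

Lemma swap_continuous : continuous swap.
Proof. by move=> p; apply: cvg_pair; [exact: cvg_snd|exact: cvg_fst]. Qed.

Lemma smooth_swap (D : set (V * W)) : open D -> smooth_on D swap.
Proof. by move=> oD; split => // k; apply: Ck_on_linear; exact: swap_continuous. Qed.

End swap.

(** The exchange of the two factors is its own inverse. *)
Lemma diffeomorphic_swap (R : realType) (V W : normedModType R)
    (A : set V) (B : set W) : open (A `*` B) -> open (B `*` A) ->
  diffeomorphic (A `*` B) (B `*` A).
Proof.
move=> oAB oBA; exists (@swap R V W), (@swap R W V).
split; [exact: smooth_swap|exact: smooth_swap| |].
  by move=> [x y] [].
by move=> [x y] [].
Qed.

Lemma sum_delta (R : pzRingType) (I : finType) (i : I) (f : I -> R) :
  \sum_j (i == j)%:R * f j = f i.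
Proof.
rewrite (bigD1 i) //= eqxx mul1r big1 ?addr0 // => j ji.
by rewrite eq_sym (negPf ji) mul0r.
Qed.

(** The Sherman-Morrison inverse of diag(d) + x^T x. *)
Lemma sherman_morrison (R : fieldType) (m : nat) (d x : 'I_m -> R) (q : R) :
  (forall i, d i != 0) -> q != 0 -> q = 1 + \sum_i x i ^+ 2 / d i ->
  (\matrix_(i, j) ((i == j)%:R * d i + x i * x j)) *m
  (\matrix_(i, j) ((i == j)%:R / d i - x i / d i * (x j / d j) / q)) = 1%:M.
Proof.
move=> d0 q0 qE; apply/matrixP => i k; rewrite !mxE.
have hk : \sum_j x j * ((j == k)%:R / d j - x j / d j * (x k / d k) / q) =
    x k / d k / q.
  under eq_bigr => j _.
    rewrite mulrBr (_ : x j * ((j == k)%:R / d j) = (k == j)%:R * (x j / d j));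
      last by rewrite eq_sym mulrCA.
    rewrite (_ : x j * (x j / d j * (x k / d k) / q) =
      (x j ^+ 2 / d j) * (x k / d k / q)); last by ring.
    over.
  rewrite big_split /= sumrN -mulr_suml sum_delta.
  have -> : \sum_j x j ^+ 2 / d j = q - 1 by rewrite qE addrC addKr.
  by field; rewrite q0 d0.
transitivity (\sum_j ((i == j)%:R * (d i * ((j == k)%:R / d j - x j / d j * (x k / d k) / q)))
   + x i * \sum_j x j * ((j == k)%:R / d j - x j / d j * (x k / d k) / q)).
  rewrite mulr_sumr -big_split; apply: eq_bigr => j _ /=; rewrite !mxE; ring.
rewrite hk sum_delta; field; by rewrite q0 !d0.
Qed.

Section lagrangian.
Variables (R : realType) (m : nat) (a psi : 'I_m -> R) (E alpha : R).
Hypotheses (a_gt0 : forall j, 0 < a j) (E_gt1 : 1 < E) (alpha_ge0 : 0 <= alpha).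

Local Notation V := ('rV[R]_m * R)%type.
Local Notation r := (rfun a).
Local Notation nu := (nu a E alpha).
Local Notation dnu := (dnu a E alpha).
Local Notation kappa := (kappa a alpha).
Local Notation L := (Lparam a psi E alpha).
Local Notation dL := (dL a psi E alpha).
Local Notation ddL := (ddL a psi E alpha).
Local Notation rotv := (rotv a psi E alpha).
Local Notation dom := (Ldomain R m).

(** The squared norm 1 + sum_j x_j^2 / r_j^2 of the vector V. *)
Definition qf (p : V) : R := 1 + \sum_j p.1 0 j ^+ 2 / r j p.2 ^+ 2.

Lemma qf_gt0 p : 0 < qf p.
Proof.
by rewrite ltr_pwDl // sumr_ge0 // => j _; rewrite divr_ge0 ?sqr_ge0.
Qed.

Lemma speed_gt0 p : dom p -> 0 < p.2 ^+ 2 + nu p.2 ^+ 2.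
Proof. by case=> _ p0; rewrite ltr_pwDl ?sqr_ge0 // exprn_even_gt0. Qed.

Lemma omega_dL p (v w : V) : omega (dL v p) (dL w p) = 0.
Proof.
rewrite omega_rotv.
transitivity (\sum_j (nu p.2 * w.2 * (p.1 0 j * v.1 0 j) - nu p.2 * v.2 * (p.1 0 j * w.1 0 j))
  + (nu p.2 * v.2 * (\sum_j p.1 0 j * w.1 0 j) - nu p.2 * w.2 * (\sum_j p.1 0 j * v.1 0 j))).
  congr (_ + _); last by ring.
  by apply: eq_bigr => j _; field; exact: rfun_neq0.
by rewrite big_split /= sumrN -!mulr_sumr; ring.
Qed.

Lemma edot_dL p (v w : V) : edot (dL v p) (dL w p) =
  \sum_j r j p.2 ^+ 2 * (v.1 0 j * w.1 0 j) +
  (\sum_j p.1 0 j * v.1 0 j) * (\sum_j p.1 0 j * w.1 0 j) +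
  (p.2 ^+ 2 + nu p.2 ^+ 2) * qf p * (v.2 * w.2).
Proof.
rewrite edot_rotv /qf.
transitivity (\sum_j (r j p.2 ^+ 2 * (v.1 0 j * w.1 0 j)
    + p.2 * w.2 * (p.1 0 j * v.1 0 j) + p.2 * v.2 * (p.1 0 j * w.1 0 j)
    + (p.2 ^+ 2 + nu p.2 ^+ 2) * (v.2 * w.2) * (p.1 0 j ^+ 2 / r j p.2 ^+ 2))
  + ((- (\sum_j p.1 0 j * v.1 0 j) + p.2 * v.2) *
     (- (\sum_j p.1 0 j * w.1 0 j) + p.2 * w.2) + nu p.2 * v.2 * (nu p.2 * w.2))).
  by congr (_ + _); apply: eq_bigr => j _; field; exact: rfun_neq0.
by rewrite !big_split /= -!mulr_sumr; ring.
Qed.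

Lemma dL_inj p (v : V) : dom p -> dL v p = 0 -> v = 0.
Proof.
move=> Dp v0; have := edot_dL p v v; rewrite v0 linear0 => /esym/eqP.
have s1 : 0 <= \sum_j r j p.2 ^+ 2 * (v.1 0 j * v.1 0 j).
  by apply: sumr_ge0 => j _; rewrite mulr_ge0 ?sqr_ge0 // -expr2 sqr_ge0.
have sq_ge0 (y : R) : 0 <= y * y by rewrite -expr2 sqr_ge0.
have N0 := speed_gt0 Dp; have q0 := qf_gt0 p.
have s3 : 0 <= (p.2 ^+ 2 + nu p.2 ^+ 2) * qf p * (v.2 * v.2).
  by rewrite mulr_ge0 // ltW // mulr_gt0.
rewrite paddr_eq0 ?addr_ge0 //.
rewrite paddr_eq0 // => /andP[/andP[+ _] +].
rewrite !mulf_eq0 (gt_eqF N0) (gt_eqF q0) /= orbb => hx /eqP hs.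
case: v hx hs {v0 s1 s3} => x s /= hx ->; congr pair; apply/rowP => j; rewrite mxE.
move: hx; rewrite psumr_eq0 => [/allP hx|k _]; last first.
  by rewrite mulr_ge0 // sqr_ge0.
have := hx j (mem_index_enum _).
by rewrite -expr2 mulf_eq0 !sqrf_eq0 (negPf (rfun_neq0 a_gt0 _ _)) /= => /eqP.
Qed.

Lemma lagrangian_Lparam : lagrangian_on dom L.
Proof.
split; last first.
  by move=> p Dp v w; rewrite !diff_Lparam // omega_dL.
split; first exact: smooth_Lparam.
move=> p Dp v w vw; apply/eqP; rewrite -subr_eq0; apply/eqP.
by apply: (dL_inj Dp); rewrite -diff_Lparam // linearB /= vw subrr.
Qed.

(** The inverse of the induced metric. *)
Definition metric_inv (p : V) : 'M[R]_(m + 1) :=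
  block_mx
    (\matrix_(i, j) ((i == j)%:R / r i p.2 ^+ 2 -
       p.1 0 i / r i p.2 ^+ 2 * (p.1 0 j / r j p.2 ^+ 2) / qf p))
    0 0 ((p.2 ^+ 2 + nu p.2 ^+ 2) * qf p)^-1%:M.

Lemma induced_metricE p : dom p -> induced_metric L p =
  block_mx (\matrix_(i, j) ((i == j)%:R * r i p.2 ^+ 2 + p.1 0 i * p.1 0 j))
    0 0 ((p.2 ^+ 2 + nu p.2 ^+ 2) * qf p)%:M.
Proof.
move=> Dp; have sum_x0 (k : 'I_m) : \sum_j p.1 0 j * (delta_mx 0 k : 'rV[R]_m) 0 j = p.1 0 k.
  rewrite -[RHS](sum_delta k (fun j => p.1 0 j)); apply: eq_bigr => j _.
  by rewrite mxE eqxx /= mulrC eq_sym.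
have sum_00 : \sum_j p.1 0 j * (0 : 'rV[R]_m) 0 j = 0.
  by apply: big1 => j _; rewrite mxE mulr0.
have sum_0l w : \sum_j r j p.2 ^+ 2 * ((0 : 'rV[R]_m) 0 j * w 0 j) = 0.
  by apply: big1 => j _; rewrite mxE mul0r mulr0.
have sum_0r (w : 'rV[R]_m) : \sum_j r j p.2 ^+ 2 * (w 0 j * (0 : 'rV[R]_m) 0 j) = 0.
  by apply: big1 => j _; rewrite mxE !mulr0.
apply/matrixP => i j; rewrite mxE !diff_Lparam // edot_dL //.
case: (split_ordP i) => i' ->; case: (split_ordP j) => j' ->;
  rewrite ?coord_frame_lshift ?coord_frame_rshift /=.
- rewrite block_mxEul !mxE !sum_x0 !mulr0 addr0; congr (_ + _).
  rewrite (bigD1 i') //= !mxE !eqxx big1 ?addr0 => [|k ki].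
    by rewrite mulrC /= mul1r.
  by rewrite !mxE (negPf ki) /= mul0r mulr0.
- by rewrite block_mxEur !mxE sum_00 sum_0r mul0r !mulr0 !addr0.
- by rewrite block_mxEdl !mxE sum_00 sum_0l !mul0r !mulr0 !addr0.
- by rewrite block_mxEdr !mxE sum_00 sum_0l mul0r !addr0 add0r !ord1 eqxx !mulr1.
Qed.

Lemma metric_mulV p : dom p -> induced_metric L p *m metric_inv p = 1%:M.
Proof.
move=> Dp; rewrite induced_metricE // mulmx_block !mulmx0 !mul0mx !addr0 !add0r.
have r2 i : r i p.2 ^+ 2 != 0 by rewrite expf_neq0 // rfun_neq0.
have q0 : qf p != 0 by rewrite gt_eqF // qf_gt0.
rewrite (sherman_morrison r2 q0 (erefl _)) -scalar_mxM mulfV.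
  by rewrite -scalar_mx_block.
by rewrite mulf_neq0 // gt_eqF // speed_gt0.
Qed.

Lemma unit_metric p : dom p -> induced_metric L p \in unitmx.
Proof. by move=> /metric_mulV/mulmx1_unit[]. Qed.

Lemma invmx_metric p : dom p -> invmx (induced_metric L p) = metric_inv p.
Proof.
move=> Dp; have := congr1 (mulmx (invmx (induced_metric L p))) (metric_mulV Dp).
by rewrite mulmxA mulVmx ?unit_metric // mul1mx mulmx1.
Qed.

(** The unit vector of the real axis of the last factor. *)
Definition e_last (t : R) : RCn R (m + 1) := rotv t (fun=> 0) (fun=> 0) 1 0.

Lemma TvecE t : Tvec m alpha = alpha *: e_last t.
Proof.
apply: RCnP => i; rewrite linearZ /=; case: (split_ordP i) => j ->; rewrite rotvE
  /re_part /im_part !mxE ?(unsplitK (inl j)) ?(unsplitK (inr j)) !mxE /=;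
  by rewrite /GRing.scale /=; ring.
Qed.

Lemma ddL_coord p (i j : 'I_m) :
  ddL (delta_mx 0 i, 0) (delta_mx 0 j, 0) p = - (i == j)%:R *: e_last p.2.
Proof.
have -> : ddL (delta_mx 0 i, 0) (delta_mx 0 j, 0) p =
    rotv p.2 (fun=> 0) (fun=> 0) (- (i == j)%:R) 0.
  rewrite /ddL /=; congr rotv; rewrite ?mulr0 ?addr0 //.
  - by apply/funext => k; rewrite !mulr0 mul0r !addr0 mulr0.
  - by apply/funext => k; rewrite !mulr0 mul0r !addr0 mulr0.
  congr (- _); rewrite (bigD1 i) //= !mxE !eqxx mul1r big1 ?addr0 // => k ki.
  by rewrite !mxE (negPf ki) mul0r.
apply: RCnP => k; rewrite linearZ /=; case: (split_ordP k) => l ->; rewrite !rotvE;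
  by rewrite /GRing.scale /=; ring.
Qed.

(** The trace of the second derivative with respect to the induced metric. *)
Definition trace_ddL (p : V) : RCn R (m + 1) :=
  \sum_i \sum_j metric_inv p i j *: ddL (coord_frame R i) (coord_frame R j) p.

Lemma trace_ddLE p : trace_ddL p =
  - (\sum_k (r k p.2 ^+ 2)^-1 -
     (\sum_k (p.1 0 k / r k p.2 ^+ 2) ^+ 2) / qf p) *: e_last p.2 +
  ((p.2 ^+ 2 + nu p.2 ^+ 2) * qf p)^-1 *: ddL (0, 1) (0, 1) p.
Proof.
rewrite /trace_ddL big_split_ord big_ord1; congr (_ + _); last first.
  rewrite big_split_ord big_ord1 /= big1 ?add0r => [|j _]; last first.
    by rewrite block_mxEdl mxE scale0r.
  by rewrite block_mxEdr !coord_frame_rshift mxE eqxx mulr1n.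
rewrite opprB mulr_suml -sumrB scaler_suml; apply: eq_bigr => i _.
rewrite big_split_ord big_ord1 /= block_mxEur mxE scale0r addr0.
rewrite (bigD1 i) //= big1 ?addr0 => [|j ji]; last first.
  by rewrite !coord_frame_lshift ddL_coord eq_sym (negPf ji) oppr0 scale0r scaler0.
rewrite block_mxEul mxE coord_frame_lshift ddL_coord eqxx scalerA; congr (_ *: _).
by rewrite mulrN1 opprB mul1r -expr2.
Qed.

(** The reason is the identity s nu' = nu (1 - |w|^2 kappa), by which [dnu] is
    defined. *)
Lemma trace_ddL_tangent p : dom p -> exists v, trace_ddL p - Tvec m alpha = dL v p.
Proof.
move=> Dp; have p0 : p.2 != 0 by case: Dp.
pose N := p.2 ^+ 2 + nu p.2 ^+ 2.
pose Z := \sum_k (p.1 0 k / r k p.2 ^+ 2) ^+ 2.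
have N0 : N != 0 by rewrite gt_eqF // speed_gt0.
have q0 : qf p != 0 by rewrite gt_eqF // qf_gt0.
have n0 : nu p.2 != 0 by exact: nu_neq0.
have r0 j : r j p.2 != 0 by exact: rfun_neq0.
(* The coefficient cs of d_s L is read off from the imaginary part of the last
   coordinate, the coefficients c j of d_(x_j) L from the first coordinates; the
   real part of the last coordinate then is a condition, which dnu satisfies. *)
pose cs := dnu p.2 / (nu p.2 * N * qf p).
pose c j := p.1 0 j / r j p.2 ^+ 2 * (kappa p.2 / qf p) -
            p.1 0 j / (qf p * r j p.2 ^+ 4).
have csE : p.2 * cs = (N^-1 - kappa p.2) / qf p.
  by rewrite /cs /dnu -/N; field; rewrite p0 n0 N0 q0.
have sum_c : \sum_j p.1 0 j * c j = (qf p - 1) * (kappa p.2 / qf p) - Z / qf p.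
  rewrite /qf [1 + _ - 1]addrC addKr -/(qf p) /Z !mulr_suml -sumrB.
  by apply: eq_bigr => j _; rewrite /c; field; rewrite q0 r0.
exists (\row_j c j, cs).
rewrite trace_ddLE (TvecE p.2) -/N -/Z.
have eqK : \sum_k (r k p.2 ^+ 2)^-1 = kappa p.2 - alpha by rewrite /kappa addrK.
apply: RCnP => i; rewrite linearB linearD !linearZ /= /GRing.scale /=.
  case: (split_ordP i) => j ->; rewrite !rotvE /= ?mxE -/N.
    rewrite -(mulrA _ p.2 cs) csE /c /cs.
    by field; rewrite ?r0 ?q0 ?n0 ?N0.
  rewrite csE mulr1 eqK.
  have -> : \sum_k p.1 0 k * (\row_k c k) 0 k =
      (qf p - 1) * (kappa p.2 / qf p) - Z / qf p.
    by rewrite -sum_c; apply: eq_bigr => k _; rewrite mxE.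
  rewrite big1 => [|k _]; last by rewrite mxE mul0r.
  by field; rewrite ?q0 ?N0.
case: (split_ordP i) => j ->; rewrite !rotvE /= ?mxE -/N.
  rewrite -(mulrA _ p.2 cs) csE /c /cs.
  by field; rewrite ?r0 ?q0 ?n0 ?N0.
by rewrite /cs; field; rewrite ?q0 ?n0 ?N0.
Qed.

Lemma mean_curvature_Lparam p : dom p ->
  mean_curvature L p = normal_part L p (Tvec m alpha).
Proof.
move=> Dp; rewrite mean_curvatureE ?unit_metric // invmx_metric //.
apply: normal_part_congr.
have [v vE] := trace_ddL_tangent Dp.
exists v => //; rewrite diff_Lparam // -vE; congr (_ - _).
by apply: eq_bigr => i _; apply: eq_bigr => j _; rewrite derive2_Lparam.
Qed.

End lagrangian.

Theorem theorem1p5 (R : realType) (m : nat) (hn : (2 <= m + 1)%N)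
    (a psi : 'I_m -> R) (E alpha : R)
    (ha : forall j, 0 < a j) (hE : 1 < E) (halpha : 0 <= alpha) :
  [/\ lagrangian_on (Ldomain R m) (Lparam a psi E alpha),
      Lparam a psi E alpha @` Ldomain R m = Lset a psi E alpha,
      diffeomorphic (Ldomain R m) ([set s : R | s != 0] `*` [set: 'rV[R]_m]) &
      forall p, Ldomain R m p ->
        mean_curvature (Lparam a psi E alpha) p =
        normal_part (Lparam a psi E alpha) p (Tvec m alpha)].
Proof.
split.
- exact: lagrangian_Lparam.
- apply/seteqP; split => [_ [[x s] [_ /= s0] <-]|z [x [s [s0 ->]]]].
    by exists x, s.
  by exists (x, s).
- apply: diffeomorphic_swap; first exact: Ldomain_open.
  have -> : [set s : R | s != 0] `*` [set: 'rV[R]_m] = fst @^-1` [set s | s != 0].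
    by apply/seteqP; split => -[s x] //= [].
  by apply: open_comp => [z _|]; [exact: cvg_fst|exact: open_neq].
- by move=> p Dp; exact: mean_curvature_Lparam.
Qed.
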